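(* Let $\mathcal{H}$ be a complex Hilbert space, let $T\in\mathcal{B}(\mathcal{H})$ be generalized Drazin invertible with closed range, let $T^{-}$ be a fixed inner inverse of $T$ and let $T^{GD-}=T^dTT^{-}$ be the corresponding GD1 inverse. Then: (i) $T^{GD-}T=T^dT$ is a projector onto $\mathcal{R}(T^dT)$ along $\mathcal{N}(T^dT)$. (ii) $TT^{GD-}$ is a projector onto $\mathcal{R}(TT^dT)$ along $\mathcal{N}(T^dT^{-})$. (iii) $T^{GD-}TT^{GD-}=T^{GD-}$, $\mathcal{R}(T^{GD-})=\mathcal{R}(T^dT)$ and $\mathcal{N}(T^{GD-})=\mathcal{N}(T^dT^{-})$.
   Context: $\mathcal{B}(\mathcal{H})$ is the space of bounded linear operators on $\mathcal{H}$; $\mathcal{R}(\cdot)$ and $\mathcal{N}(\cdot)$ denote range and null space. An operator $Q$ is quasinilpotent if $\|Q^n\|^{1/n}\to0$. $T\in\mathcal{B}(\mathcal{H})$ is generalized Drazin invertible if there is $X\in\mathcal{B}(\mathcal{H})$ with $XTX=X$, $TX=XT$ and $T-T^2X$ quasinilpotent; such an $X$ is unique and is denoted $T^d$. An inner inverse of $T$ is $T^{-}\in\mathcal{B}(\mathcal{H})$ with $TT^{-}T=T$ (one exists iff $\mathcal{R}(T)$ is closed). A projector onto $M$ along $N$ is a bounded idempotent (not necessarily self-adjoint) with range $M$ and null space $N$. *)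

(* Defs.v *)
From HB Require Import structures.
From mathcomp Require Import all_boot all_order all_algebra.
From mathcomp Require Import complex.
From mathcomp Require Import all_classical all_reals all_analysis.

Set Implicit Arguments.
Unset Strict Implicit.
Unset Printing Implicit Defensive.

Import Order.TTheory GRing.Theory Num.Theory.
Import numFieldNormedType.Exports.

Local Open Scope classical_set_scope.
Local Open Scope complex_scope.
Local Open Scope ring_scope.

(* The library norm of a module over R[i] takes its values in R[i]; an element
   r of R is compared with it through r%:C. *)
HB.mixin Record CompleteNormedModule_isHilbert (R : realType) (H : Type)
    of CompleteNormedModule R[i] H := {
  (* linear in the first argument, conjugate-linear in the second *)
  hdot : {dot H for (@Num.conj R[i])} ;
  hdot_norm : forall x : H, `|x| ^+ 2 = hdot x x }.

#[short(type="hilbertType")]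
HB.structure Definition Hilbert (R : realType) :=
  { H of CompleteNormedModule_isHilbert R H & CompleteNormedModule R[i] H }.

Section BoundedOperators.
Context (R : realType) (H : hilbertType R).

Definition bounded_op (f : H -> H) :=
  exists M : R, forall x, `|f x| <= M%:C * `|x|.

Record bop := Bop {
  bop_fun :> H -> H ;
  bop_linear : linear bop_fun ;
  bop_bounded : bounded_op bop_fun }.

HB.instance Definition _ (T : bop) :=
  GRing.isLinear.Build R[i] H H *:%R T (bop_linear T).

Lemma bopP (S T : bop) : (forall x, S x = T x) -> S = T.
Proof.
case: S T => [f lf bf] [g lg bg] /= /funext fg.
by move: lf bf; rewrite fg => lf bf; congr Bop; exact: Prop_irrelevance.
Qed.

HB.instance Definition _ := gen_eqMixin bop.
HB.instance Definition _ := gen_choiceMixin bop.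

Lemma bounded_opP (f : H -> H) : bounded_op f ->
  exists2 M : R, 0 <= M & forall x, `|f x| <= M%:C * `|x|.
Proof.
move=> [M fM]; exists (Num.max 0 M); first by rewrite le_max lexx.
move=> x; apply: (le_trans (fM x)); rewrite ler_wpM2r// lecR.
by rewrite le_max lexx orbT.
Qed.

Lemma bop0_linear : linear (fun _ : H => 0 : H).
Proof. by move=> a x y; rewrite scaler0 addr0. Qed.

Lemma bop0_bounded : bounded_op (fun _ : H => 0 : H).
Proof. by exists 0 => x; rewrite normr0 mul0r. Qed.

Lemma bop1_linear : linear (@id H).
Proof. by []. Qed.

Lemma bop1_bounded : bounded_op (@id H).
Proof. by exists 1 => x; rewrite mul1r. Qed.

Lemma bopN_linear (T : bop) : linear (fun x => - T x).
Proof. by move=> a x y; rewrite linearP opprD scalerN. Qed.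

Lemma bopN_bounded (T : bop) : bounded_op (fun x => - T x).
Proof. by case: (bop_bounded T) => M TM; exists M => x; rewrite normrN. Qed.

Lemma bopD_linear (S T : bop) : linear (fun x => S x + T x).
Proof. by move=> a x y; rewrite !linearP scalerDr addrACA. Qed.

Lemma bopD_bounded (S T : bop) : bounded_op (fun x => S x + T x).
Proof.
case: (bop_bounded S) (bop_bounded T) => [M SM] [N TN]; exists (M + N) => x.
by rewrite (le_trans (ler_normD _ _))// rmorphD mulrDl lerD.
Qed.

Lemma bopM_linear (S T : bop) : linear (S \o T).
Proof. by move=> a x y /=; rewrite !linearP. Qed.

Lemma bopM_bounded (S T : bop) : bounded_op (S \o T).
Proof.
case: (bounded_opP (bop_bounded S)) (bop_bounded T) => [M M0 SM] [N TN].
exists (M * N) => x /=; rewrite (le_trans (SM _))// rmorphM -mulrA.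
by rewrite ler_wpM2l// ler0c.
Qed.

Definition bop0 := Bop bop0_linear bop0_bounded.
Definition bop1 := Bop bop1_linear bop1_bounded.
Definition bopN T := Bop (bopN_linear T) (bopN_bounded T).
Definition bopD S T := Bop (bopD_linear S T) (bopD_bounded S T).
Definition bopM S T := Bop (bopM_linear S T) (bopM_bounded S T).

Lemma bopDA : associative bopD.
Proof. by move=> S T U; apply: bopP => x /=; rewrite addrA. Qed.

Lemma bopDC : commutative bopD.
Proof. by move=> S T; apply: bopP => x /=; rewrite addrC. Qed.

Lemma bop0D : left_id bop0 bopD.
Proof. by move=> S; apply: bopP => x /=; rewrite add0r. Qed.

Lemma bopND : left_inverse bop0 bopN bopD.
Proof. by move=> S; apply: bopP => x /=; rewrite addNr. Qed.

HB.instance Definition _ := GRing.isZmodule.Build bop bopDA bopDC bop0D bopND.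

Lemma bopMA : associative bopM.
Proof. by move=> S T U; apply: bopP. Qed.

Lemma bop1M : left_id bop1 bopM.
Proof. by move=> S; apply: bopP. Qed.

Lemma bopM1 : right_id bop1 bopM.
Proof. by move=> S; apply: bopP. Qed.

Lemma bopMDl : left_distributive bopM bopD.
Proof. by move=> S T U; apply: bopP. Qed.

Lemma bopMDr : right_distributive bopM bopD.
Proof. by move=> S T U; apply: bopP => x /=; rewrite linearD. Qed.

(* [pzRingType]: 1 = 0 holds on the zero Hilbert space. *)
HB.instance Definition _ := GRing.Zmodule_isPzRing.Build bop
  bopMA bop1M bopM1 bopMDl bopMDr.

End BoundedOperators.

Notation "''B' ( H )" := (bop H) (at level 8, format "''B' ( H )") : type_scope.

Section GeneralizedDrazin.
Context (R : realType) (H : hilbertType R).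
Implicit Types T S X Q P : 'B(H).

Definition null T : set H := [set x | T x = 0].

Definition opnorm T : R :=
  sup [set complex.Re `|T x| | x in [set x : H | `|x| <= 1]].

Definition quasinilpotent Q :=
  opnorm (Q ^+ n) `^ n%:R^-1 @[n --> \oo] --> (0 : R).

Definition is_gdrazin T X :=
  [/\ X * T * X = X, T * X = X * T & quasinilpotent (T - T ^+ 2 * X)].

Definition gdrazin_invertible T := exists X, is_gdrazin T X.

(* The generalized Drazin inverse of T, with junk value 0 when there is none. *)
Definition gdrazin T : 'B(H) := xget 0 [set X | is_gdrazin T X].

Definition inner_inverse T S := T * S * T = T.

Definition gd1 T S : 'B(H) := gdrazin T * T * S.

Definition projector P (M N : set H) :=
  [/\ P * P = P, range P = M & null P = N].

Lemma opnorm_bound T x : `|T x| <= (opnorm T)%:C * `|x|.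
Proof.
have normE (y : H) : `|y| = (complex.Re `|y|)%:C.
  by rewrite RRe_real// ger0_real.
have [->|x0] := eqVneq x 0; first by rewrite linear0 !normr0 mulr0.
have nx : 0 < `|x| by rewrite normr_gt0.
pose y := (`|x|^-1) *: x.
have ny : `|y| = 1 by rewrite normrZ normfV normr_id mulVf ?gt_eqF.
suff : `|T y| <= (opnorm T)%:C.
  by rewrite linearZ/= normrZ normfV normr_id ler_pdivrMl// mulrC.
rewrite normE lecR; apply: ub_le_sup; last by exists y => //=; rewrite ny.
case: (bounded_opP (bop_bounded T)) => M M0 TM.
exists M => _ [z /= z1 <-]; rewrite -lecR -normE (le_trans (TM z))//.
by rewrite ler_piMr// ler0c.
Qed.

Lemma opnorm_le T (M : R) : 0 <= M ->
  (forall x, `|T x| <= M%:C * `|x|) -> opnorm T <= M.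
Proof.
move=> M0 TM; apply: ge_sup.
  by exists (complex.Re `|T 0|); exists 0 => //=; rewrite normr0 ler01.
move=> _ [z /= z1 <-]; rewrite -lecR RRe_real ?ger0_real//.
by rewrite (le_trans (TM z))// ler_piMr// ler0c.
Qed.

Lemma opnorm_ge0 T : 0 <= opnorm T.
Proof.
case: (bounded_opP (bop_bounded T)) => M M0 TM.
apply: ub_le_sup; last by exists 0 => /=; rewrite ?linear0 normr0 ?ler01.
exists M => _ [z /= z1 <-]; rewrite -lecR RRe_real ?ger0_real//.
by rewrite (le_trans (TM z))// ler_piMr// ler0c.
Qed.

Lemma opnormM S T : opnorm (S * T) <= opnorm S * opnorm T.
Proof.
apply: opnorm_le => [|x]; first by rewrite mulr_ge0 ?opnorm_ge0.
rewrite (le_trans (opnorm_bound S _))// rmorphM -mulrA ler_wpM2l//.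
  by rewrite ler0c opnorm_ge0.
exact: opnorm_bound.
Qed.

Lemma opnorm_eq0 T : opnorm T = 0 -> T = 0.
Proof.
move=> T0; apply: bopP => x; apply/normr0_eq0/eqP.
by rewrite eq_le normr_ge0 andbT (le_trans (opnorm_bound T x))// T0 mul0r.
Qed.

Lemma quasinilpotent_pow Q (c : R) : quasinilpotent Q -> 0 <= c ->
  c ^+ n * opnorm (Q ^+ n) @[n --> \oo] --> (0 : R).
Proof.
move=> qQ c0; have c1 : 0 < c + 1 by rewrite ltr_wpDl.
apply: (@squeeze_cvgr _ _ _ _ (cst 0) (fun n => 2^-1 ^+ n)).
- have : (2 * (c + 1))^-1 > 0 :> R by rewrite invr_gt0 mulr_gt0.
  move/cvgr0Pnorm_le : qQ => /[apply] qQ.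
  near=> n.
  rewrite mulr_ge0 ?exprn_ge0 ?opnorm_ge0//=.
  have n0 : (0 < n)%N by near: n; exact: nbhs_infty_gt.
  have : `|opnorm (Q ^+ n) `^ n%:R^-1| <= (2 * (c + 1))^-1 by near: n.
  rewrite ger0_norm ?powR_ge0// => le_root.
  have -> : opnorm (Q ^+ n) = (opnorm (Q ^+ n) `^ n%:R^-1) ^+ n.
    rewrite -powR_mulrn ?powR_ge0// -powRrM mulVf ?pnatr_eq0 -?lt0n//.
    by rewrite powRr1 ?opnorm_ge0.
  rewrite -exprMn lerXn2r ?nnegrE ?mulr_ge0 ?powR_ge0//.
  rewrite (le_trans (ler_pM _ _ (_ : c <= c + 1) le_root)) ?powR_ge0//.
    by rewrite lerDl.
  by rewrite invfM mulrCA mulfV ?mulr1// gt_eqF.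
- exact: cvg_cst.
- by apply: cvg_expr; rewrite ger0_norm ?invf_lt1 ?ltr1n.
Unshelve. all: by end_near. Qed.

Let gdrazin_idem T X : is_gdrazin T X -> (T * X) * (T * X) = T * X.
Proof. by move=> [XTX _ _]; rewrite mulrA -(mulrA T X T) -mulrA XTX. Qed.

Lemma gdrazin_unique T X Y : is_gdrazin T X -> is_gdrazin T Y -> X = Y.
Proof.
have comm_sub X' Y' : is_gdrazin T X' -> is_gdrazin T Y' ->
    (T * X') * (1 - T * Y') = 0 /\ (1 - T * Y') * (T * X') = 0.
  move=> gX gY; have [_ TX _] := gX; have [_ TY qY] := gY.
  have idX := gdrazin_idem gX; have idY := gdrazin_idem gY.
  set Q := T - T ^+ 2 * Y' in qY.
  have idC : (1 - T * Y') * (1 - T * Y') = 1 - T * Y'.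
    by rewrite mulrBl mul1r mulrBr mulr1 idY subrr subr0.
  have QE : Q = T * (1 - T * Y') by rewrite /Q mulrBr mulr1 expr2 mulrA.
  have cT : T * (1 - T * Y') = (1 - T * Y') * T.
    by rewrite mulrBr mulrBl mulr1 mul1r TY mulrA TY.
  have QXE n : Q ^+ n.+1 = T ^+ n.+1 * (1 - T * Y').
    elim: n => [|n IH]; first by rewrite !expr1.
    rewrite exprS IH QE mulrA -(mulrA T) (commrX n.+1 (esym cT)) mulrA.
    by rewrite -exprS -mulrA idC.
  have pX n : T * X' = X' ^+ n.+1 * T ^+ n.+1.
    elim: n => [|n IH]; first by rewrite !expr1.
    rewrite exprSr [T ^+ n.+2]exprS mulrA -(mulrA _ X' T) -TX.
    rewrite -(mulrA _ (T * X')) (commrX n.+1 (_ : GRing.comm (T * X') T)).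
      by rewrite mulrA -IH idX.
    by rewrite /GRing.comm {2}TX mulrA.
  have pX' n : T * X' = T ^+ n.+1 * X' ^+ n.+1.
    by rewrite (pX n); apply/commrX/commr_sym/commrX.
  have cvg0 (Z : 'B(H)) :
      (forall n, opnorm Z <= opnorm X' ^+ n.+1 * opnorm (Q ^+ n.+1)) -> Z = 0.
    move=> ZQ; apply: opnorm_eq0; apply/eqP.
    rewrite eq_le opnorm_ge0 andbT.
    have := quasinilpotent_pow qY (opnorm_ge0 X').
    rewrite -(cvg_shiftS (fun n => opnorm X' ^+ n * opnorm (Q ^+ n))) => h.
    apply: (ler_cvg_to (cvg_cst _) h); exact: nearW.
  have Xn n : opnorm (X' ^+ n.+1) <= opnorm X' ^+ n.+1.
    elim: n => [|n IH]; first by rewrite !expr1.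
    rewrite exprS [leRHS]exprS (le_trans (opnormM _ _))//.
    by rewrite ler_wpM2l ?opnorm_ge0.
  split; apply: cvg0 => n.
    rewrite (pX n) -mulrA -QXE (le_trans (opnormM _ _))//.
    by rewrite ler_wpM2r ?opnorm_ge0.
  rewrite (pX' n) mulrA (commrX n.+1 (esym cT)) -QXE.
  by rewrite (le_trans (opnormM _ _))// mulrC ler_wpM2r ?opnorm_ge0.
move=> gX gY; have [XTX TX _] := gX; have [YTY TY _] := gY.
have [a _] := comm_sub _ _ gX gY; have [_ b] := comm_sub _ _ gY gX.
have e : T * X = T * Y.
  move/eqP : a; rewrite mulrBr mulr1 subr_eq0 => /eqP ->.
  by move/eqP : b; rewrite mulrBl mul1r subr_eq0 => /eqP.
by rewrite -XTX -mulrA e mulrA -TX e TY.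
Qed.

Lemma gdrazinP T : gdrazin_invertible T -> is_gdrazin T (gdrazin T).
Proof. by move=> [X gX]; exact: (xgetPex 0 (ex_intro _ X gX)). Qed.

End GeneralizedDrazin.

(* Main.v *)
Require Import Defs.
From mathcomp Require Import all_boot all_order all_algebra.
From mathcomp Require Import all_classical all_reals all_analysis.

Import GRing.Theory.
Local Open Scope classical_set_scope.
Local Open Scope ring_scope.

(** Write [D] for [gdrazin T] and [G] for [D * T * Tm]. Since [T * Tm * T = T], the product [G * T]
    collapses to [D * T], which is idempotent because [D * T * D = D]; hence [G * T * G = G], and
    [T * G] is idempotent too. Ranges and null spaces then agree because the operators compared are
    multiples of each other, on the right for ranges ([range_mul_eq]) and on the left for null
    spaces ([null_mul_eq]). *)

(** Right multiplication cannot enlarge a range, so two mutual right multiples have ranges contained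
    in each other. *)
Lemma range_mul_eq (R : realType) (H : hilbertType R) (A B C E : 'B(H)) :
  A = B * C -> B = A * E -> range A = range B.
Proof.
move=> AE BE; apply/seteqP; split=> _ [x _ <-].
  by exists (C x); rewrite // AE.
by exists (E x); rewrite // [in RHS]BE.
Qed.

(** Dually, left multiplication cannot shrink a null space. *)
Lemma null_mul_eq (R : realType) (H : hilbertType R) (A B C E : 'B(H)) :
  A = C * B -> B = E * A -> null A = null B.
Proof.
move=> AE BE; apply/seteqP; split=> x; rewrite /null /= => x0.
  by rewrite BE; change (E (A x) = 0); rewrite x0 linear0.
by rewrite AE; change (C (B x) = 0); rewrite x0 linear0.
Qed.

Theorem theorem3 (R : realType) (H : hilbertType R) (T Tm : 'B(H))
    (hT : gdrazin_invertible T) (hcl : closed (range T))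
    (hTm : inner_inverse T Tm) :
  (gd1 T Tm * T = gdrazin T * T /\
    projector (gd1 T Tm * T) (range (gdrazin T * T)) (null (gdrazin T * T))) /\
  projector (T * gd1 T Tm)
    (range (T * gdrazin T * T)) (null (gdrazin T * Tm)) /\
  (gd1 T Tm * T * gd1 T Tm = gd1 T Tm /\
    range (gd1 T Tm) = range (gdrazin T * T) /\
    null (gd1 T Tm) = null (gdrazin T * Tm)).
Proof.
have [DTD TD _] := gdrazinP hT.
rewrite /gd1; move: (gdrazin T) DTD TD => D DTD TD.
have GT : D * T * Tm * T = D * T by rewrite -!mulrA (mulrA T Tm) hTm.
have idDT : (D * T) * (D * T) = D * T by rewrite mulrA DTD.
have GTG : D * T * Tm * T * (D * T * Tm) = D * T * Tm.
  by rewrite GT (mulrA (D * T)) idDT.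
(* Commuting [T] past [D] makes [G] a left multiple of [D * Tm]; [DSE] is the converse, as
   [D * T * D = D]. *)
have GE : D * T * Tm = T * (D * Tm) by rewrite -TD mulrA.
have DSE : D * Tm = D * (D * T * Tm) by rewrite GE !mulrA DTD.
split; first by rewrite GT; split.
split; last split=> //.
  split.
  - by rewrite -mulrA (mulrA (D * T * Tm)) GTG.
  - apply: (range_mul_eq _ _ _ _ Tm T); first by rewrite !mulrA.
    by rewrite -!mulrA (mulrA T Tm) hTm.
  (* [D * D] undoes [T * T] here: [D * D * (T * G)] is [D * (D * T) * (D * T) * Tm], which
     idempotence of [D * T] and then [DSE] reduce to [D * Tm]. *)
  - apply: (null_mul_eq _ _ _ _ (T * T) (D * D)); first by rewrite GE mulrA.
    by rewrite {1}DSE -{1}idDT !mulrA.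
split; first exact: (range_mul_eq _ _ _ _ Tm T).
exact: (null_mul_eq _ _ _ _ T D).
Qed.
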